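(* Let $q\in\mathbb{N}$ with $q\ge 3$ and let $\mathcal{A}\subseteq\{0,1,\ldots,q-1\}$ with $1<\#\mathcal{A}<q$. Let $p_1,\ldots,p_\ell\in\mathbb{N}_{\ge2}$ be such that each $p_j$ has a prime factor that does not divide $q$. Then for every positive rational $\alpha$, the set $\{(k_1,\ldots,k_\ell)\in\mathbb{N}_0^\ell: \alpha/(p_1^{k_1}\cdots p_\ell^{k_\ell})\in K(q,\mathcal{A})\}$ is finite.
   Context: $\mathbb{N}_0=\mathbb{N}\cup\{0\}$. $K(q,\mathcal{A}):=\{\sum_{i=1}^\infty d_i q^{-i}: d_i\in\mathcal{A}\ \forall i\in\mathbb{N}\}$. *)

(* Defs.v *)
From HB Require Import structures.
From mathcomp Require Import all_boot all_order all_algebra.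
From mathcomp Require Import all_classical all_reals all_analysis.
Set Implicit Arguments.
Unset Strict Implicit.
Unset Printing Implicit Defensive.

Import Order.TTheory GRing.Theory Num.Theory.
Import numFieldNormedType.Exports.
Local Open Scope classical_set_scope.
Local Open Scope ring_scope.

(* The digit sequence is indexed from 0, so [d i] is the digit multiplying
   [q ^- i.+1]. *)
Definition K (R : realType) (q : nat) (A : {set 'I_q}) : set R :=
  [set x : R | exists d : nat -> 'I_q,
     (forall i, d i \in A) /\
     [series (d i)%:R * q%:R ^- i.+1 : R]_i @ \oo --> x].

(* Main.v *)
Require Import Defs.
From HB Require Import structures.
From mathcomp Require Import all_boot all_order all_algebra.
From mathcomp Require Import cyclic.
From mathcomp Require Import all_classical all_reals all_analysis.
From mathcomp Require Import zify.
Set Implicit Arguments.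
Unset Strict Implicit.
Unset Printing Implicit Defensive.

Import Order.TTheory GRing.Theory Num.Theory.
Import numFieldNormedType.Exports.
Local Open Scope classical_set_scope.

(* Write the point as [a / B] and let [b] be the largest divisor of [B] coprime
   to [q]. Choose [Q], a power of [q] congruent to 1 modulo the square of every
   prime that can divide [b]. Then [n |-> 1 + Q + ... + Q ^ n.-1] is a bijection
   of the residues mod [b], so the residues of [a Q ^ n] fill a full coset of
   the subgroup generated by [g = gcd (a (Q - 1), b)], and [g] stays bounded
   while [b] grows. Once [b > q g], some [q ^ N a / B] has its fractional part
   strictly inside the interval [c / q, (c + 1) / q] of a digit [c] outside [A],
   which forces that digit into the expansion. Hence [b], and with it every
   exponent [k_j], is bounded. *)

(** * Geometric sums and orbits of powers modulo an integer *)

Lemma geom_sum_mod1 d Q n :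
  Q = 1 %[mod d] -> \sum_(i < n) Q ^ i = n %[mod d].
Proof.
move=> Q1; rewrite -modn_summ.
under eq_bigr => i _ do rewrite -modnXm Q1 modnXm exp1n.
by rewrite modn_summ sum1_card card_ord.
Qed.

Lemma geom_sumD Q m n :
  \sum_(i < m + n) Q ^ i = \sum_(i < m) Q ^ i + Q ^ m * \sum_(i < n) Q ^ i.
Proof.
rewrite big_split_ord /= big_distrr /=; congr (_ + _).
by apply: eq_bigr => i _; rewrite expnD.
Qed.

Lemma geom_sumM Q r n :
  \sum_(i < r * n) Q ^ i =
  (\sum_(i < r) Q ^ i) * (\sum_(i < n) (Q ^ r) ^ i).
Proof.
elim: n => [|n IH]; first by rewrite muln0 !big_ord0 muln0.
rewrite big_ord_recr /= mulnDr -IH mulnS addnC big_split_ord /=.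
congr (_ + _); rewrite big_distrl /=; apply: eq_bigr => i _.
by rewrite expnD mulnC expnM.
Qed.

(* Dividing out one prime factor [r] of [b] at a time: for [n = r * n'] the
   sum factors as [\sum_(i < r) Q ^ i], which is [r] times a unit mod [b],
   and the corresponding sum for [Q ^ r] with [n'] terms. *)
Lemma dvdn_geom_sum b Q n : 0 < b ->
  (forall r, prime r -> r %| b -> Q = 1 %[mod r ^ 2]) ->
  b %| \sum_(i < n) Q ^ i -> b %| n.
Proof.
elim/ltn_ind: b Q n => b IH Q n b0 Q1 bS.
have [b1|b1] := leqP b 1; first by have -> : b = 1 by [lia]; rewrite dvd1n.
have Q1' r : prime r -> r %| b -> Q = 1 %[mod r].
  move=> rp rb; have := Q1 r rp rb => /(congr1 (modn^~ r)).
  by rewrite !modn_dvdm // expnS dvdn_mulr.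
have rp := pdiv_prime b1; set r := pdiv b in rp.
have rb : r %| b by exact: pdiv_dvd.
have /dvdnP[n' En] : r %| n.
  have := dvdn_trans rb bS.
  by rewrite /dvdn (geom_sum_mod1 _ (Q1' _ rp rb)).
have r2 : \sum_(i < r) Q ^ i = r %[mod r ^ 2] by exact: geom_sum_mod1 (Q1 _ rp rb).
have /dvdnP[w Ew] : r %| \sum_(i < r) Q ^ i.
  by rewrite /dvdn (geom_sum_mod1 _ (Q1' _ rp rb)) modnn.
(* Modulo a common prime [s] of [b] and [w] the sum is both 0 and [r], so [s = r]. Then [r ^ 2]
   divides the sum, which is [r] modulo [r ^ 2]. *)
have cw : coprime b w.
  rewrite coprime_has_primes //; last first.
    rewrite lt0n; apply/eqP => w0; move: Ew; rewrite w0 mul0n => Ew.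
    move: r2; rewrite Ew mod0n modn_small; first by move/esym: (prime_gt0 rp); lia.
    by rewrite -{1}(expn1 r) ltn_exp2l ?prime_gt1.
  apply/hasPn => s; rewrite !mem_primes => /and3P[sp w0 sw].
  apply/negP => /and3P[_ _ sb].
  have sr : s = r.
    apply/eqP; rewrite -dvdn_prime2 // /dvdn -(geom_sum_mod1 _ (Q1' _ sp sb)).
    by rewrite Ew -/(dvdn _ _) dvdn_mulr.
  have : r ^ 2 %| r.
    rewrite /dvdn -r2 Ew -/(dvdn _ _) (expnS r 1) expn1 dvdn_pmul2r ?prime_gt0 //.
    by rewrite -sr.
  move/(dvdn_leq (prime_gt0 rp)); rewrite -mulnn leqNgt.
  by rewrite -{1}(muln1 r) ltn_pmul2l ?prime_gt0 ?prime_gt1.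
have /dvdnP[b' Eb] := rb.
have b'0 : 0 < b' by move: b0; rewrite Eb muln_gt0 => /andP[].
have b'b : b' < b by rewrite Eb -{1}(muln1 b') ltn_pmul2l ?prime_gt1.
rewrite Eb En dvdn_pmul2r ?prime_gt0 //.
apply: (IH b' b'b (Q ^ r)) => // [s sp sb'|].
  have sb : s %| b by rewrite Eb dvdn_mulr.
  by rewrite -modnXm Q1 // modnXm exp1n.
have : b' * r %| r * (w * \sum_(i < n') (Q ^ r) ^ i).
  by rewrite -Eb mulnA [r * w]mulnC -Ew -geom_sumM [r * n']mulnC -En.
rewrite mulnC dvdn_pmul2l ?prime_gt0 // Gauss_dvdr //.
by apply: coprime_dvdl cw; rewrite Eb dvdn_mulr.
Qed.

(** Two sums differ by a power of [Q], a unit mod [b], times a sum of [n - m] terms. Hence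
    [dvdn_geom_sum] makes the map injective on the finite type ['I_b], so bijective. *)
Lemma geom_sum_surj b Q t : 0 < b -> coprime b Q ->
  (forall r, prime r -> r %| b -> Q = 1 %[mod r ^ 2]) ->
  exists n, \sum_(i < n) Q ^ i = t %[mod b].
Proof.
move=> b0 cbQ Q1.
pose f (n : 'I_b) : 'I_b := Ordinal (ltn_pmod (\sum_(i < n) Q ^ i) b0).
have le_inj (m n : 'I_b) : m <= n -> f m = f n -> m = n.
  move=> mn /(congr1 val) /= /esym/eqP.
  have := geom_sumD Q m (n - m); rewrite subnKC // => ->.
  rewrite eqn_mod_dvd ?leq_addr // addKn Gauss_dvdr ?coprimeXr //.
  move=> /(dvdn_geom_sum b0 Q1) bd.
  apply/val_inj/eqP; rewrite /= eqn_leq mn -subn_eq0 /=.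
  have [|nm0] := posnP (n - m); first lia.
  by have := dvdn_leq nm0 bd; have := ltn_ord n; lia.
have f_inj : injective f.
  move=> m n fmn; case: (leqP m n) => [/le_inj|/ltnW/le_inj]; first exact.
  by move=> h; exact/esym/h.
have [g _ gK] := injF_bij f_inj.
pose t' := Ordinal (ltn_pmod t b0).
exists (g t'); have /(congr1 val) /= := gK t'; exact.
Qed.

(** Since [a * Q ^ n] is [a] plus [a * Q.-1] times a geometric sum, it takes mod [b] every value
    congruent to [a] mod [g]. An interval of length [b / q > g] contains such a value. *)
Lemma pow_orbit_hits_interval b q c a Q :
  0 < a -> 1 < Q -> coprime b Q ->
  (forall r, prime r -> r %| b -> Q = 1 %[mod r ^ 2]) ->
  q * gcdn (a * Q.-1) b < b -> c < q ->
  exists n, c * b < q * ((a * Q ^ n) %% b) < c.+1 * b.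
Proof.
move=> a0 Q1 cbQ QP gb cq; have b0 : 0 < b by exact: leq_ltn_trans gb.
have aQ0 : 0 < a * Q.-1 by rewrite muln_gt0 a0; lia.
set g := gcdn _ _ in gb.
have g0 : 0 < g by rewrite gcdn_gt0 aQ0.
have gdb : g %| b by exact: dvdn_gcdr.
(* [s] is the representative of [a] mod [g] among [w + 1, ..., w + g]; the factor [g.-1] plays the
   role of -1. *)
pose w := c * b %/ q; pose s := w.+1 + (a + g.-1 * w.+1) %% g.
have Ew : c * b = w * q + (c * b) %% q by exact: divn_eq.
have wr : (c * b) %% q < q by rewrite ltn_mod; lia.
have dl : (a + g.-1 * w.+1) %% g < g by rewrite ltn_mod.
have s_gt : c * b < q * s.
  by rewrite Ew /s mulnDr mulnS [w * q]mulnC; lia.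
have s_lt : q * s < c.+1 * b.
  have : q * s <= q * (w + g) by rewrite leq_mul2l /s; apply/orP; right; lia.
  by rewrite mulnDr mulSn Ew [w * q]mulnC; lia.
have sb : s < b.
  have q0 : 0 < q by lia.
  by rewrite -(ltn_pmul2l q0); apply: leq_trans s_lt _; rewrite leq_mul2r cq orbT.
(* Adding [b * a], which is 0 mod [b] and mod [g], keeps the subtraction of [a] from truncating. *)
have a_le : a <= s + b * a.
  by apply: leq_trans (leq_addl _ _); rewrite -{1}(mul1n a) leq_mul2r b0 orbT.
have sa : s = a %[mod g].
  rewrite /s modnDmr addnCA -mulSn prednK //.
  by rewrite addnC mulnC modnMDl.
have /dvdnP[j Ej] : g %| s + b * a - a.
  rewrite -eqn_mod_dvd //.
  by rewrite -modnDmr -modnMml (eqP gdb) mul0n mod0n addn0 sa.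
have [km kn Eg _] := egcdnP b aQ0.
have [n En] := geom_sum_surj (km * j) b0 cbQ QP.
exists n; suff -> : (a * Q ^ n) %% b = s by rewrite s_gt s_lt.
have -> : a * Q ^ n = a + a * Q.-1 * \sum_(i < n) Q ^ i.
  by rewrite -mulnA -predn_exp -mulnS prednK // expn_gt0 ltnW.
rewrite -modnDmr -modnMmr En modnMmr modnDmr.
have -> : a + a * Q.-1 * (km * j) = kn * j * b + (s + b * a).
  have -> : a * Q.-1 * (km * j) = (km * (a * Q.-1)) * j by lia.
  rewrite Eg mulnDl -/g [g * j]mulnC -Ej.
  by rewrite addnCA subnKC // mulnAC.
by rewrite modnMDl addnC mulnC modnMDl modn_small.
Qed.

(** * Digit expansions *)

Local Open Scope ring_scope.

(* The integer [q ^ n * \sum_(i < n) d i / q ^ i.+1] read off the first [n]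
   digits. *)
Fixpoint digits_val (q : nat) (d : nat -> nat) (n : nat) : nat :=
  if n is m.+1 then (q * digits_val q d m + d m)%N else 0%N.

Lemma digits_val_series (R : realType) (q : nat) (d : nat -> nat) n :
  (0 < q)%N ->
  [series (d i)%:R * q%:R ^- i.+1 : R]_i n = (digits_val q d n)%:R / q%:R ^+ n.
Proof.
move=> q0; have qn0 : q%:R != 0 :> R by rewrite pnatr_eq0 -lt0n.
elim: n => [|n IH]; first by rewrite /series /= big_geq // mul0r.
rewrite -[LHS]/(series _ n.+1) seriesSr IH /= natrD natrM mulrDl; congr (_ + _).
by rewrite exprS invfM mulrACA mulfV // mul1r.
Qed.

(** The partial sums [s] increase to [x]. Raised by [q ^- n] they become [t], which decreases
    because digits are at most [q - 1], so [x] stays between the two. *)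
Lemma digits_val_cvg_bounds (R : realType) (q : nat) (d : nat -> nat) (x : R) n :
  (0 < q)%N -> (forall i, (d i < q)%N) ->
  [series (d i)%:R * q%:R ^- i.+1 : R]_i @ \oo --> x ->
  (digits_val q d n)%:R <= q%:R ^+ n * x <= (digits_val q d n).+1%:R.
Proof.
move=> q0 dq dx.
have qR i : 0 < q%:R ^+ i :> R by rewrite exprn_gt0 // ltr0n.
pose s n : R := (digits_val q d n)%:R / q%:R ^+ n.
have sx : s @ \oo --> x.
  by apply: cvg_trans dx; apply: near_eq_cvg; near=> m; rewrite digits_val_series.
pose t n : R := (digits_val q d n).+1%:R / q%:R ^+ n.
have s_le m : (n <= m)%N -> s n <= s m.
  apply: (@homo_leq _ s (fun a b => a <= b)) => // [a b c|{}m]; first exact: le_trans.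
  rewrite /s ler_pdivrMr // exprS invfM mulrA mulfVK ?gt_eqF //.
  by rewrite ler_pdivlMr ?ltr0n // -natrM ler_nat /= mulnC leq_addr.
have t_le m : (n <= m)%N -> t m <= t n.
  apply: (@homo_leq _ t (fun a b => b <= a)) => // [a b c ? ?|{}m].
    exact: (@le_trans _ _ a).
  rewrite /t ler_pdivlMr // exprS invfM mulrA mulfVK ?gt_eqF //.
  rewrite ler_pdivrMr ?ltr0n // -natrM ler_nat /=.
  by have := dq m; rewrite mulSn; lia.
have st m : s m <= t m by rewrite /s /t ler_pM2r ?invr_gt0 // ler_nat.
rewrite mulrC -ler_pdivrMr // -[X in _ && X]ler_pdivlMr //; apply/andP; split.
  by apply: (cvgr_to_ge sx); near=> m; apply: s_le; near: m; exact: nbhs_infty_ge.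
apply: (cvgr_to_le sx); near=> m; apply: (le_trans (st m)).
by apply: t_le; near: m; exact: nbhs_infty_ge.
Unshelve. all: by end_near.
Qed.

(* A missing digit [c] contradicts [c / q < frac (q ^ N * a / B) < (c + 1) / q],
   written here over the integers with [q ^ N * a / B = y / b]. *)
Lemma K_digit_mem (R : realType) (q : nat) (A : {set 'I_q}) (c : 'I_q)
    (a B b y N : nat) : (0 < B)%N -> (0 < b)%N -> K A (a%:R / B%:R : R) ->
  (q ^ N * a * b = y * B)%N -> (c * b < q * (y %% b) < c.+1 * b)%N -> c \in A.
Proof.
move=> B0 b0 [d [dA dx]] yE /andP[clt ltc].
have q0 : (0 < q)%N by case: c {clt ltc} => c /= ; lia.
pose e := digits_val q d; have eS n : e n.+1 = (q * e n + d n)%N by [].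
have eb n z : (q ^ n * a * b = z * B)%N -> (e n * b <= z <= (e n).+1 * b)%N.
  move=> zE.
  have := digits_val_cvg_bounds n q0 (fun i => ltn_ord (d i)) dx; rewrite -/(e n).
  have -> : q%:R ^+ n * (a%:R / B%:R) = z%:R / b%:R :> R.
    apply/eqP; rewrite mulrA eqr_div ?pnatr_eq0 -?lt0n //.
    by rewrite -natrX -!natrM zE.
  by rewrite ler_pdivlMr ?ltr0n // ler_pdivrMr ?ltr0n // -!natrM !ler_nat.
have /andP[e1 e2] := eb _ _ yE.
have /eb : (q ^ N.+1 * a * b = q * y * B)%N by rewrite expnS -!mulnA -yE !mulnA.
rewrite eS => /andP[e3 e4].
have qyE : (q * y = q * (y %/ b) * b + q * (y %% b))%N.
  by rewrite -mulnA -mulnDr -divn_eq.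
have y_gt0 : (0 < y %% b)%N by rewrite lt0n; apply/eqP => y0; rewrite y0 in clt; lia.
(* A nonzero remainder excludes [y = (e N).+1 * b], the case of an expansion ending in digits
   [q - 1]. *)
have eN : e N = (y %/ b)%N.
  apply/eqP; rewrite eqn_leq; apply/andP; split.
    by rewrite leq_divRL.
  by rewrite -ltnS ltn_divLR // ltn_neqAle e2 andbT; apply/eqP => yb;
     rewrite yb modnMl in y_gt0.
move: e3 e4; rewrite eN qyE => e3 e4.
have dc : (d N < c.+1)%N.
  rewrite -(ltn_pmul2r b0); apply: leq_ltn_trans ltc.
  by rewrite -(leq_add2l (q * (y %/ b) * b)) -mulnDl.
have cd : (c < (d N).+1)%N.
  rewrite -(ltn_pmul2r b0); apply: leq_trans clt _.
  by rewrite -(leq_add2l (q * (y %/ b) * b)) -mulnDl addnS.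
by have -> : c = d N by apply/val_inj => /=; lia.
Qed.

(** * Bounding the denominator and the exponents *)

Lemma pi_nat_dvdn_expn (q n : nat) : \pi(q).-nat n -> exists m, (n %| q ^ m)%N.
Proof.
move=> qn; have /andP[n0 _] := qn; exists n; apply/dvdn_partP => // r rn.
have : r \in \pi(q) by exact: (pnatPpi qn).
rewrite mem_primes => /and3P[rp q0 rq].
rewrite p_part; apply: (dvdn_trans (dvdn_exp2r _ rq)).
by apply: dvdn_exp2l; apply/ltnW/ltn_logl.
Qed.

(** By Euler, [Q = q ^ totient (P ^ 2)] is 1 modulo [r ^ 2] for each prime [r] of [b]. The bound
    depends on [B] only through [P], which can serve many denominators at once. *)
Lemma K_denominator_bound (R : realType) (q : nat) (A : {set 'I_q}) (c : 'I_q)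
    (a B P : nat) : (1 < q)%N -> c \notin A -> (0 < a)%N -> (0 < B)%N ->
  (0 < P)%N -> coprime q P ->
  (forall r, prime r -> (r %| B`_(\pi(q)^'))%N -> (r %| P)%N) ->
  K A (a%:R / B%:R : R) ->
  (B`_(\pi(q)^') <= q * (a * (q ^ totient (P ^ 2)).-1))%N.
Proof.
move=> q1 cA a0 B0 P0 qP bP aK; rewrite leqNgt; apply: contra cA => b_gt.
set M := totient (P ^ 2) in b_gt; set b := (B`_(\pi(q)^'))%N in bP b_gt.
have b0 : (0 < b)%N by exact: part_gt0.
have M0 : (0 < M)%N by rewrite totient_gt0 expn_gt0 P0.
(* Multiplying by [q ^ m] clears the primes of [q] from [B]: [q ^ m * a / B = a * h / b]. *)
have [m /dvdnP[h hE]] := pi_nat_dvdn_expn (part_pnat \pi(q) B).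
have cbq : coprime b q.
  by apply: p'nat_coprime (part_pnat _ _) _; apply: pnat_pi; lia.
have qm0 : (0 < q ^ m)%N by rewrite expn_gt0 ltnW.
have h0 : (0 < h)%N by move: qm0; rewrite hE muln_gt0 => /andP[].
have cbh : coprime b h.
  by apply: (@coprime_dvdr _ (q ^ m)); rewrite ?coprimeXr // hE dvdn_mulr.
have [||||||n cn] := @pow_orbit_hits_interval b q c (a * h) (q ^ M).
- by rewrite muln_gt0 a0.
- by rewrite -{1}(exp1n M) ltn_exp2r.
- by rewrite coprimeXr.
- move=> r rp rb; have rP : (r ^ 2 %| P ^ 2)%N by rewrite dvdn_exp2r // bP.
  have := @Euler_exp_totient q (P ^ 2).
  rewrite coprimeXr // => /(_ isT) /(congr1 (modn^~ (r ^ 2)%N)).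
  by rewrite !modn_dvdm.
(* As [h] is coprime to [b], it drops out of the gcd, so the bound is free of [m]. *)
- apply: leq_ltn_trans b_gt; rewrite leq_mul2l; apply/orP; right.
  rewrite mulnAC gcdnC Gauss_gcdl // dvdn_leq ?dvdn_gcdr // muln_gt0 a0.
  by rewrite -ltnS prednK ?expn_gt0 ?(ltnW q1) // -{1}(exp1n M) ltn_exp2r.
- exact: ltn_ord.
apply: (K_digit_mem B0 b0 aK _ cn (N := m + M * n)).
rewrite expnD expnM hE -[in RHS](partnC \pi(q) B0) -/b.
set x := (B`_ _)%N; set z := ((q ^ M) ^ n)%N; lia.
Qed.

Lemma finite_set_bounded_ffun (l C : nat) (S : set {ffun 'I_l -> nat}) :
  (forall k, S k -> forall j, (k j < C)%N) -> finite_set S.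
Proof.
move=> SC; pose f (g : {ffun 'I_l -> 'I_C}) := [ffun j => val (g j)].
apply: (@sub_finite_set _ _ (f @` setT)) => [k /SC kC|].
  exists [ffun j => Ordinal (kC j)] => //.
  by apply/ffunP => j; rewrite !ffunE.
exact/finite_image/finite_finset.
Qed.

Theorem theorem4p1 (R : realType) (q : nat) (hq : (3 <= q)%N)
    (A : {set 'I_q}) (hA : (1 < #|A| < q)%N)
    (l : nat) (p : 'I_l -> nat) (hp2 : forall j, (2 <= p j)%N)
    (hp : forall j, exists r : nat,
        [/\ prime r, (r %| p j)%N & ~~ (r %| q)%N])
    (alpha : rat) (halpha : 0 < alpha) :
  finite_set [set k : {ffun 'I_l -> nat} |
    K A (ratr alpha / \prod_(j < l) (p j)%:R ^+ k j : R)].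
Proof.
have q1 : (1 < q)%N by lia.
have [c cA] : exists c, c \notin A.
  apply/existsP; rewrite -negb_forall; apply/negP => /forallP AT.
  have : A = [set: 'I_q]%SET by apply/setP => c; rewrite inE AT.
  by move=> AE; rewrite AE cardsT card_ord ltnn andbF in hA.
pose u := `|numq alpha|%N; pose v := `|denq alpha|%N.
have u0 : (0 < u)%N by rewrite absz_gt0 numq_eq0 gt_eqF.
have v0 : (0 < v)%N by rewrite absz_gt0 denq_neq0.
have alphaE : ratr alpha = u%:R / v%:R :> R.
  rewrite /ratr /u /v -[X in X%:~R / _]gez0_abs; last by rewrite numq_ge0 ltW.
  by rewrite -[X in _ / X%:~R]gez0_abs // denq_ge0.
have p0 j : (0 < p j)%N by exact: ltnW.
pose B (k : {ffun 'I_l -> nat}) := (v * \prod_(j < l) p j ^ k j)%N.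
have B0 k : (0 < B k)%N.
  by rewrite muln_gt0 v0 prodn_gt0 // => j; rewrite expn_gt0 p0.
pose V := (v * \prod_(j < l) p j)%N.
have V0 : (0 < V)%N by rewrite muln_gt0 v0 prodn_gt0.
(* Every prime outside [q] that divides some [B k] divides [P], which does not depend on [k]. *)
pose P := (V`_(\pi(q)^'))%N.
have cqP : coprime q P.
  by apply: pnat_coprime (part_pnat _ _); apply: pnat_pi; lia.
apply: (@finite_set_bounded_ffun _ (q * (u * (q ^ totient (P ^ 2)).-1))).
move=> k kK j.
have bP r : prime r -> (r %| (B k)`_(\pi(q)^'))%N -> (r %| P)%N.
  move=> rp rb.
  have rq : ((\pi(q)^').-nat r)%N by apply: pnat_dvd rb (part_pnat _ _).
  have rV : (r %| V)%N.
    have : (r %| B k)%N by apply: dvdn_trans rb (dvdn_part _ _).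
    rewrite /V !Euclid_dvdM // => /orP[->//|].
    rewrite !Euclid_dvd_prod // !big_orE => /existsP[i] /=.
    rewrite Euclid_dvdX // => /andP[ri _]; apply/orP; right.
    by apply/existsP; exists i.
  by rewrite -(part_pnat_id rq); apply: partn_dvd.
have {}kK : K A (u%:R / (B k)%:R : R).
  move: kK; rewrite /= alphaE /B natrM natr_prod invfM mulrA.
  by under eq_bigr => i _ do rewrite -natrX.
apply: leq_trans (K_denominator_bound q1 cA u0 (B0 k) (part_gt0 _ _) cqP bP kK).
(* For a prime [r] of [p j] outside [q], [r ^ k j] divides the bounded part of [B k], and
   [k j < r ^ k j]. *)
have [r [rp rpj rq]] := hp j.
have rk : ((\pi(q)^').-nat (r ^ k j))%N.
  by rewrite pnatX pnatE // inE /= mem_primes rp (negPf rq) !andbF.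
have := part_gt0 (\pi(q)^')%N (B k).
have : (r ^ k j %| (B k)`_(\pi(q)^'))%N.
  rewrite -(part_pnat_id rk); apply: partn_dvd => //.
  apply: (dvdn_trans (dvdn_exp2r _ rpj)).
  by rewrite /B (bigD1 j) //= mulnCA dvdn_mulr.
move=> /dvdn_leq /[apply]; apply: leq_trans.
exact: (ltn_expl _ (prime_gt1 rp)).
Qed.
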